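(* Let $G$ be a subgroup of $\mathbb{R}$ that contains $\mathbb{Z}$, let $I$ be an infinite index set, let $J\subseteq I$, and let $n\in\mathbb{N}$. The following extensions $ws$-split: (a) $E_1=\big(\mathbb{Z}^J\xrightarrow{j}G^I\xrightarrow{p}(G/\mathbb{Z})^J\oplus G^{I\setminus J}\big)$. (b) $E_2=\big((\mathbb{Z}^n)^\sharp\xrightarrow{j}(\mathbb{R}^n)^\sharp\xrightarrow{p}(\mathbb{R}^n/\mathbb{Z}^n)^\sharp\big)$. (c) $E_3=\big((\mathbb{Z}^J)^\sharp\xrightarrow{j}(G^I)^\sharp\xrightarrow{p}(G^J/\mathbb{Z}^J)^\sharp\oplus(G^{I\setminus J})^\sharp\big)$, where $J$ is finite. (d) $E=\big((\mathbb{Z}^J)^\sharp\xrightarrow{j}(\mathbb{R}^I)^\sharp\xrightarrow{p}(\mathbb{R}^J/\mathbb{Z}^J)^\sharp\oplus(\mathbb{R}^{I\setminus J})^\sharp\big)$, where $J$ is finite.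
   Context: For an Abelian group $H$, $H^\sharp$ denotes the group $H$ equipped with the Bohr topology, i.e. the initial topology with respect to the family of all homomorphisms of the abstract group $H$ to $\mathbb{T}$, where $\mathbb{T}=\mathbb{R}/\mathbb{Z}$ has its usual topology. Groups written without $\sharp$, as in (a), carry their usual topologies: $G\subseteq\mathbb{R}$ the Euclidean topology, $\mathbb{Z}$ the discrete topology, $G/\mathbb{Z}$ the quotient topology, and powers the product topology. For a set $J$, $H^J$ is the full direct product; a finite direct sum $\oplus$ of topological groups has the product topology. In each case $j$ and $p$ are the canonical maps: $j$ is the inclusion on the coordinates in $J$ and zero on the coordinates in $I\setminus J$, and $p$ is the quotient map on the coordinates in $J$ and the identity on the coordinates in $I\setminus J$ (in (b), $j$ is the inclusion and $p$ the quotient map). An extension of topological Abelian groups is a sequence $B\xrightarrow{j}X\xrightarrow{p}A$ of continuous homomorphisms where $p$ is surjective and open and $j$ is a topological embedding with image $p^{-1}(0)$. It $ws$-splits (is a $ws$-extension) if there is a continuous map $\mathbf{s}\colon A\to X$ (not necessarily a homomorphism) with $p\mathbf{s}=\mathrm{id}_A$ and $\mathbf{s}(0)=0$.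
   Formalization: Part (a) is stated only when J is empty or G is a proper subgroup of ℝ; for G = ℝ and J nonempty it is false, since a continuous section would give a continuous section of ℝ → ℝ/ℤ, which does not exist. *)

(* Defs.v *)
From HB Require Import structures.
From mathcomp Require Import all_boot all_algebra.
From mathcomp Require Import all_classical reals topology normedtype.
Import GRing.Theory.
Import numFieldNormedType.Exports.

Set Implicit Arguments.
Unset Strict Implicit.
Unset Printing Implicit Defensive.

Local Open Scope classical_set_scope.
Local Open Scope ring_scope.

Section ExtensionDef.
Context {B X A : topologicalZmodType}.

Definition is_open_map (p : X -> A) : Prop :=
  forall U : set X, open U -> open (p @` U).

Definition is_embedding (j : B -> X) : Prop :=
  injective j /\
  forall U : set B, open U <-> exists2 V : set X, open V & U = j @^-1` V.

Definition is_extension (j : B -> X) (p : X -> A) : Prop :=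
  [/\ zmod_morphism j /\ continuous j,
      zmod_morphism p /\ continuous p,
      (forall a, exists x, p x = a) /\ is_open_map p,
      is_embedding j &
      range j = p @^-1` [set 0]].

Definition ws_extension (j : B -> X) (p : X -> A) : Prop :=
  is_extension j p /\
  exists s : A -> X, [/\ continuous s, cancel s p & s 0 = 0].

End ExtensionDef.

Section InitialContinuity.

Lemma continuous_to_initial (Y : topologicalType) (S : choiceType)
    (T : topologicalType) (f : S -> T) (h : Y -> S) :
  continuous (f \o h) -> continuous (h : Y -> initial_topology f).
Proof.
move=> /continuousP cfh; apply/continuousP => _ [A oA <-].
by rewrite -comp_preimage; exact: cfh.
Qed.

Lemma continuous_to_sup_initial (Y : topologicalType) (S : choiceType)
    (D : Type) (T : D -> topologicalType) (f : forall d, S -> T d)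
    (h : Y -> S) :
  (forall d, continuous (f d \o h)) ->
  continuous (h : Y -> sup_topology
    (fun d => Topological.class (initial_topology (f d)))).
Proof.
move=> cfh y; apply/cvg_sup => d.
exact: (continuous_to_initial (cfh d)).
Qed.

Lemma sup_initial_continuous (S : choiceType) (D : Type)
    (T : D -> topologicalType) (f : forall d, S -> T d) d :
  continuous (f d : sup_topology
    (fun d => Topological.class (initial_topology (f d))) -> T d).
Proof.
move=> y A nA; have /= h := @initial_continuous _ _ (f d) y A nA.
have /cvg_sup/(_ d) : nbhs (y : sup_topology
    (fun d => Topological.class (initial_topology (f d)))) --> y by [].
exact.
Qed.

Lemma continuous_sub2 (Y : topologicalType) (T : topologicalZmodType)
    (g : Y -> T) :
  continuous g -> continuous (fun z : Y * Y => g z.1 - g z.2).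
Proof.
move=> cg [x y]; apply: (@continuous_comp _ _ _
  (fun z : Y * Y => (g z.1, g z.2)) (fun z : T * T => z.1 - z.2));
  last exact: sub_continuous.
apply: cvg_pair => /=.
- move=> W nW; have := cg _ _ nW. exact: (cvg_fst (F:=nbhs x) (G:=nbhs y)).
- move=> W nW; have := cg _ _ nW. exact: (cvg_snd (F:=nbhs x) (G:=nbhs y)).
Qed.

End InitialContinuity.

Definition dint : Type := discrete_topology int.

HB.instance Definition _ := Topological.copy dint (discrete_topology int).
HB.instance Definition _ := GRing.Zmodule.copy dint int.

Lemma dint_sub_continuous : continuous (fun x : dint * dint => x.1 - x.2).
Proof.
move=> [x y] A /= /nbhs_singleton/= Axy.
exists ([set x], [set y]) => /=; last by move=> [u v] /= [-> ->].
by split; exact: (@discrete_set1 (discrete_topology int)).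
Qed.

HB.instance Definition _ :=
  PreTopologicalNmodule_isTopologicalZmodule.Build dint dint_sub_continuous.

Definition subgrp (V : topologicalZmodType) (S : zmodClosed V) : Type :=
  {x : V | x \in S}.

Section Subgrp.
Context (V : topologicalZmodType) (S : zmodClosed V).

HB.instance Definition _ := [isSub for (@sval _ _ : subgrp S -> V)].
HB.instance Definition _ := [Choice of subgrp S by <:].
HB.instance Definition _ := [SubChoice_isSubZmodule of subgrp S by <:].
HB.instance Definition _ :=
  Topological.copy (subgrp S) (initial_topology (val : subgrp S -> V)).

Lemma subgrp_sub_continuous :
  continuous (fun x : subgrp S * subgrp S => x.1 - x.2).
Proof.
apply: continuous_to_initial.
exact: (continuous_sub2 (@initial_continuous (subgrp S) V val)).
Qed.

HB.instance Definition _ :=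
  PreTopologicalNmodule_isTopologicalZmodule.Build (subgrp S)
    subgrp_sub_continuous.

End Subgrp.

Definition quotgrp (V : topologicalZmodType) (S : zmodClosed V) : Type :=
  quotient_topology (Quotient.quot S).

Section Quotgrp.
Context (V : topologicalZmodType) (S : zmodClosed V).

HB.instance Definition _ :=
  Topological.copy (quotgrp S) (quotient_topology (Quotient.quot S)).
(* The group structure is rebuilt from the operations of Quotient.quot because
   quotient_topology does not reuse its choiceType structure. *)
HB.instance Definition _ := @GRing.isZmodule.Build (quotgrp S)
  (Quotient.zero S) (@Quotient.opp _ S) (@Quotient.add _ S)
  (@Quotient.addqA _ S) (@Quotient.addqC _ S)
  (@Quotient.add0q _ S) (@Quotient.addNq _ S).

Definition quotproj (x : V) : quotgrp S := \pi_(Quotient.quot S)%qT x.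

Lemma quotproj_is_zmod_morphism : zmod_morphism quotproj.
Proof. exact: (raddfB (\pi_(Quotient.quot S)%qT)). Qed.

HB.instance Definition _ := GRing.isZmodMorphism.Build V (quotgrp S) quotproj
  quotproj_is_zmod_morphism.

Lemma quotproj_continuous : continuous quotproj.
Proof. exact: pi_continuous. Qed.

Lemma quotproj_surj (a : quotgrp S) : exists x, quotproj x = a.
Proof. by exists (repr (a : Quotient.quot S)); rewrite /quotproj reprK. Qed.

Lemma quotproj_eq x y : quotproj x = quotproj y <-> x - y \in S.
Proof.
rewrite Quotient.idealrBE; split=> h.
  by apply/eqP; exact: h.
by move/eqP: h => h; exact: h.
Qed.

Lemma quotproj_open (U : set V) : open U -> open (quotproj @` U).
Proof.
move=> oU; rewrite /open/=/quotient_open.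
rewrite (_ : _ @^-1` _ =
    \bigcup_(s in [set` S]) ((fun x => x - s) @^-1` U)); last first.
  apply/seteqP; split=> [x/= [u Uu /quotproj_eq uxS]|x [s /= sS Ux]].
    exists (x - u); first by rewrite /= -opprB rpredN.
    by rewrite /= opprB addrC subrK.
  exists (x - s) => //; apply/quotproj_eq.
  by rewrite addrAC subrr add0r rpredN.
apply: bigcup_open => s _; apply: open_comp => // x _.
apply: (@continuous_comp _ _ _ (fun x => (x, s)) (fun x : V * V => x.1 - x.2));
  last exact: sub_continuous.
by apply: cvg_pair; [exact: cvg_id|exact: cvg_cst].
Qed.

Lemma quotproj_nbhs x (U : set V) :
  nbhs x U -> nbhs (quotproj x) (quotproj @` U).
Proof.
rewrite nbhsE => -[U0 [oU0 U0x] U0U].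
apply: (@filterS _ _ _ (quotproj @` U0)); first exact: image_subset.
by apply: open_nbhs_nbhs; split; [exact: quotproj_open|exists x].
Qed.

Lemma quotgrp_sub_continuous :
  continuous (fun x : quotgrp S * quotgrp S => x.1 - x.2).
Proof.
move=> [a b]; have [x <-] := quotproj_surj a; have [y <-] := quotproj_surj b.
move=> W /= nW; rewrite -raddfB /= in nW.
have /= [[U1 U2] /= [nU1 nU2] U12] :=
  @sub_continuous V (x, y) _ (quotproj_continuous nW).
exists (quotproj @` U1, quotproj @` U2).
  by split; exact: quotproj_nbhs.
move=> [_ _] /= [[u Uu <-] [v Uv <-]]; rewrite -raddfB.
exact: (U12 (u, v)).
Qed.

HB.instance Definition _ :=
  PreTopologicalNmodule_isTopologicalZmodule.Build (quotgrp S)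
    quotgrp_sub_continuous.

End Quotgrp.

Definition power (D K : Type) : Type := D -> K.

Section Power.
Context (D : Type) (K : topologicalZmodType).

HB.instance Definition _ := GRing.Zmodule.copy (power D K) (D -> K).
HB.instance Definition _ :=
  Topological.copy (power D K) (prod_topology (fun _ : D => K)).

Lemma power_sub_continuous :
  continuous (fun x : power D K * power D K => x.1 - x.2).
Proof.
apply: continuous_to_sup_initial => d.
apply: (continuous_sub2 (Y := power D K) (g := fun f => f d)).
exact: (@sup_initial_continuous _ D (fun=> K) (fun d f => f d)).
Qed.

HB.instance Definition _ :=
  PreTopologicalNmodule_isTopologicalZmodule.Build (power D K)
    power_sub_continuous.

End Power.

(* An alias, because the library equips A * B with a topological group
   structure only when A and B are topological vector spaces. *)
Definition dsum (A B : Type) : Type := (A * B)%type.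

Section Dsum.
Context (A B : topologicalZmodType).

HB.instance Definition _ := GRing.Zmodule.copy (dsum A B) (A * B)%type.
HB.instance Definition _ := Topological.copy (dsum A B) (A * B)%type.

Lemma dsum_sub_continuous :
  continuous (fun x : dsum A B * dsum A B => x.1 - x.2).
Proof.
move=> [[a b] [a' b']] U /= [[UA UB] /= [nA nB] UAB].
have [/= A0 [A1 A2] nA0] := @sub_continuous A (a, a') _ nA.
have [/= B0 [B1 B2] nB0] := @sub_continuous B (b, b') _ nB.
exists (A0.1 `*` B0.1, A0.2 `*` B0.2).
  by split; [exists (A0.1, B0.1)|exists (A0.2, B0.2)].
move=> [[x1 y1] [x2 y2]] /= [[? ?] [? ?]].
by apply: UAB; split; [exact: (nA0 (x1, x2))|exact: (nB0 (y1, y2))].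
Qed.

HB.instance Definition _ :=
  PreTopologicalNmodule_isTopologicalZmodule.Build (dsum A B)
    dsum_sub_continuous.

End Dsum.

Definition impred (U V : zmodType) (f : {additive U -> V}) : {pred V} :=
  [pred v | v \in range f].

Section Impred.
Context (U V : zmodType) (f : {additive U -> V}).

Lemma impredP v : reflect (exists u, f u = v) (v \in impred f).
Proof.
apply: (iffP idP) => [/set_mem[u _ <-]|[u <-]]; first by exists u.
by apply/mem_set; exists u.
Qed.

Lemma impred_zmod_closed : zmod_closed (impred f).
Proof.
split; first by apply/impredP; exists 0; rewrite raddf0.
move=> x y /impredP[u <-] /impredP[v <-].
by apply/impredP; exists (u - v); rewrite raddfB.
Qed.

HB.instance Definition _ := GRing.isZmodClosed.Build V (impred f)
  impred_zmod_closed.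

End Impred.

Definition intrr (R : realType) : int -> R := intmul 1.
HB.instance Definition _ (R : realType) :=
  GRing.Additive.copy (@intrr R) (intmul 1 : int -> R).

Definition circle (R : realType) : Type := quotgrp (impred (@intrr R)).
HB.instance Definition _ (R : realType) :=
  TopologicalZmodule.copy (circle R) (quotgrp (impred (@intrr R))).

(* R only serves to build the circle group R / Z in which the homomorphisms
   chi, which are not assumed to be continuous, take their values. *)
Definition bohr (R : realType) (H : zmodType) : Type := H.

Section Bohr.
Context (R : realType) (H : zmodType).

HB.instance Definition _ := GRing.Zmodule.on (bohr R H).
HB.instance Definition _ := Topological.copy (bohr R H)
  (sup_topology (fun chi : {additive H -> circle R} =>
    Topological.class (initial_topology chi))).

Lemma bohr_sub_continuous :
  continuous (fun x : bohr R H * bohr R H => x.1 - x.2).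
Proof.
apply: continuous_to_sup_initial => chi.
rewrite [X in continuous X](_ : _ =
    (fun z : bohr R H * bohr R H => chi z.1 - chi z.2)); last first.
  by apply/funext => z /=; rewrite raddfB.
apply: (continuous_sub2 (Y := bohr R H) (g := fun x => chi x)).
exact: (@sup_initial_continuous H {additive H -> circle R} (fun=> circle R)
  (fun chi => chi)).
Qed.

HB.instance Definition _ :=
  PreTopologicalNmodule_isTopologicalZmodule.Build (bohr R H)
    bohr_sub_continuous.

End Bohr.

Section CanonicalMaps.

Definition pwmap (D U V : Type) (f : U -> V) (m : D -> U) : D -> V := f \o m.

Lemma pwmap_is_zmod_morphism (D : Type) (U V : zmodType)
  (f : {additive U -> V}) : zmod_morphism (pwmap f : (D -> U) -> (D -> V)).
Proof. by move=> m m'; apply/funext => d; rewrite /pwmap/= raddfB. Qed.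

HB.instance Definition _ (D : Type) (U V : zmodType) (f : {additive U -> V}) :=
  GRing.isZmodMorphism.Build (D -> U) (D -> V) (pwmap f)
    (pwmap_is_zmod_morphism f).

Definition pwadd (D : Type) (U V : zmodType) (f : {additive U -> V}) :
  {additive (D -> U) -> (D -> V)} := pwmap f.

Definition intsub (R : realType) (G : zmodClosed R)
  (hG : forall m : int, m%:~R \in G) (m : int) : subgrp G := Sub m%:~R (hG m).

Lemma intsub_is_zmod_morphism (R : realType) (G : zmodClosed R)
  (hG : forall m : int, m%:~R \in G) : zmod_morphism (intsub hG).
Proof.
by move=> m m'; apply: val_inj; rewrite raddfB; exact: (raddfB (@intrr R)).
Qed.

HB.instance Definition _ (R : realType) (G : zmodClosed R)
    (hG : forall m : int, m%:~R \in G) :=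
  GRing.isZmodMorphism.Build int (subgrp G) (intsub hG)
    (intsub_is_zmod_morphism hG).

Context {I : Type} (J : set I) {K : topologicalZmodType}
  (iota : {additive int -> K}).

Definition coord_incl (m : J -> int) : I -> K := valL_ 0 (pwmap iota m).

Definition coord_quot (x : I -> K) :
    (J -> quotgrp (impred iota)) * (~` J -> K) :=
  (pwmap (quotproj (impred iota)) (sigL J x), sigL (~` J) x).

Definition coord_quot_pow (x : I -> K) :
    Quotient.quot (impred (pwadd J iota)) * (~` J -> K) :=
  (\pi_(Quotient.quot (impred (pwadd J iota)))%qT (sigL J x), sigL (~` J) x).

End CanonicalMaps.

Arguments coord_incl {I} J {K} iota m.
Arguments coord_quot {I} J {K} iota x.
Arguments coord_quot_pow {I} J {K} iota x.

(* Main.v *)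
Require Import Defs.
From HB Require Import structures.
From mathcomp Require Import all_boot all_order all_algebra.
From mathcomp Require Import all_classical reals topology normedtype.
Import Order.TTheory GRing.Theory Num.Theory.
Import numFieldNormedType.Exports.

Set Implicit Arguments.
Unset Strict Implicit.
Unset Printing Implicit Defensive.

Local Open Scope classical_set_scope.
Local Open Scope ring_scope.

(* If a real number [a] is not a value of an additive map [phi] modulo 1, then
   subtracting from [phi x] the integer that brings it into a fixed translate
   of ]a, a + 1[ is continuous and depends only on [phi x] modulo 1.  For (a),
   [phi] is the inclusion of a proper subgroup of the reals, coordinatewise.

   For the Bohr topologies, every abelian group with an element [e] of infinite
   order has a homomorphism [phi] to the rationals with [phi e = 1], so that
   [a] can be the square root of 2, even on the whole real line.  Let [b_i] be
   a basis of the lattice, [phi_i] such homomorphisms dual to it, and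
   [s t = x - \sum_i b_i *~ wind a (phi_i x)] for any lift [x] of [t].  Given a
   character [chi] with [chi b_i = r_i] mod 1, the character
   [chi0 x = \sum_i r_i * phi_i x] mod 1 agrees with [chi] on the lattice, so
   [chi (s t) = (chi - chi0) x + \sum_i r_i * reduce a (phi_i x)], where the
   first summand is a character of the quotient and the second one is
   continuous for the Bohr topology.  The same [chi0] shows that characters of
   the lattice extend, i.e. that the lattice is embedded. *)

(** * Homomorphisms to the rationals taking the value 1 at a given element *)

Lemma sqrt2_irrational (R : realType) (k : nat) (m : int) :
  (0 < k)%N -> Num.sqrt (2 : R) *+ k != m%:~R.
Proof.
move=> k0; apply/eqP => /(congr1 (fun x => x ^+ 2)).
rewrite -(mulr_natr (Num.sqrt _)) exprMn sqr_sqrtr ?ler0n//.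
rewrite -natrX -natrM -rmorphXn/= => /eqP.
have -> : (2 * k ^ 2)%:R = (2 * k ^ 2)%N%:Z%:~R :> R by [].
have -> : m ^+ 2 = (`|m| ^ 2)%N%:Z.
  by rewrite -abszX -[LHS]ger0_norm ?sqr_ge0.
rewrite eqr_int eqz_nat => /eqP km.
have m0 : (0 < `|m|)%N.
  rewrite lt0n; apply/eqP => m0; move: km; rewrite m0 => /eqP.
  by rewrite muln_eq0 expn_eq0/= andbT eqn0Ngt k0.
(* The 2-adic valuation is odd on the left and even on the right. *)
have := congr1 (logn 2) km.
rewrite lognM// ?expn_gt0 ?k0// !lognX lognE/= => /(congr1 odd).
by rewrite addSn oddS oddM/= oddM.
Qed.

Definition additive_of (U V : zmodType) (f : U -> V) (fB : zmod_morphism f) :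
  {additive U -> V} := HB.pack f (GRing.isZmodMorphism.Build U V f fB).

Section SubgroupAvoiding.
Variables (X : zmodType) (e : X).

(* The empty set is allowed, so that the union of an empty chain qualifies. *)
Definition subgroup_avoiding (A : set X) : Prop :=
  (forall x y, A x -> A y -> A (x - y)) /\
  (forall m : int, A (e *~ m) -> m = 0).

Lemma maximal_subgroup_avoiding :
  exists A, subgroup_avoiding A /\ forall B, A `<` B -> ~ subgroup_avoiding B.
Proof.
apply: Zorn_bigcup => F FP totF; split; last first.
  by move=> m [A FA Am]; exact: (FP _ FA).2 Am.
move=> x y [A FA Ax] [B FB By]; have [AB|BA] := totF _ _ FA FB.
  by exists B => //; apply: (FP _ FB).1 => //; exact: AB.
by exists A => //; apply: (FP _ FA).1 => //; exact: BA.
Qed.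

Hypothesis e_free : forall m : int, e *~ m = 0 -> m = 0.

(* If no positive multiple of [x] lies in [A + Ze] then [A + Zx] still avoids
   the nonzero multiples of [e], so a maximal [A] works. *)
Lemma rational_complement : exists A : set X,
  [/\ subgroup_avoiding A, A 0 & forall x, exists k : nat, exists m : int,
     (0 < k)%N /\ A (x *+ k - e *~ m)].
Proof.
have [A [[AB Ae] Amax]] := maximal_subgroup_avoiding.
(* Otherwise [A] is empty, hence smaller than the trivial subgroup, which qualifies by [e_free]. *)
have A0 : A 0.
  apply: contrapT => nA0.
  have A_empty x : ~ A x.
    by move=> Ax; apply: nA0; rewrite -(subrr x); exact: AB.
  apply: (Amax [set 0]).
    by split; [move=> x /A_empty | move=> /(_ 0 erefl)].
  by split=> [x y -> ->|m /e_free //]; rewrite subrr.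
have AN x : A x -> A (- x) by move=> Ax; rewrite -sub0r; exact: AB.
exists A; split => // x.
have [Ax|nAx] := pselect (A x).
  by exists 1%N, 0; rewrite mulr0z subr0.
pose B := [set v + x *~ k | v in A & k in [set: int]].
have AsubB : A `<` B.
  split; last first.
    move=> BA; apply: nAx; apply: BA.
    by exists 0 => //; exists 1; rewrite ?add0r.
  by move=> v Av; exists v => //; exists 0; rewrite ?addr0.
have := Amax B AsubB; apply: contra_notP => noq; split.
  move=> _ _ [v Av [k _ <-]] [w Aw [l _ <-]]; exists (v - w); first exact: AB.
  by exists (k - l); rewrite // mulrzBr opprD addrACA.
move=> m [v Av [k _ vkm]].
have [k0|k0] := eqVneq k 0; first by apply: Ae; rewrite -vkm k0 mulr0z addr0.
have xk : x *~ k = e *~ m - v by rewrite -vkm addrC addKr.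
exfalso; apply: noq; exists `|k|%N; rewrite absz_gt0.
case: k k0 xk {vkm} => k k0 xk.
  rewrite -pmulrn in xk; exists m; split=> //.
  by rewrite xk addrAC subrr add0r; exact: AN.
exists (- m); split => //; rewrite mulrNz opprK /=.
have -> : x *+ k.+1 = v - e *~ m by rewrite -opprB -xk NegzE mulrNz opprK.
by rewrite subrK.
Qed.

End SubgroupAvoiding.

(** With [A] from [rational_complement], put [phi x = m / k] whenever [x *+ k - e *~ m] lies in [A].
    The values are rational, so none is congruent to the square root of 2 modulo 1. *)
Lemma irrational_avoiding_hom (R : realType) (X : zmodType) (e : X) :
  (forall m : int, e *~ m = 0 -> m = 0) ->
  exists phi : {additive X -> R}, phi e = 1 /\
    forall x (m : int), phi x - Num.sqrt 2 != m%:~R.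
Proof.
move=> efree.
have [A [[AB Ae] A0 Aq]] := rational_complement efree.
have AN x : A x -> A (- x) by move=> Ax; rewrite -sub0r; exact: AB.
have AMz x m : A x -> A (x *~ m).
  move=> Ax; suff AMn n : A (x *+ n).
    by case: m => n; [exact: AMn|rewrite NegzE mulrNz; apply/AN/AMn].
  elim: n => [|n IH]; rewrite ?mulr0n// mulrS -[x *+ n]opprK.
  by apply: AB => //; exact: AN.
(* Cross-multiplying the two relations leaves [e *~ (m * l - n * k)] in [A], so the fraction [m / k]
   depends only on [x]. *)
have A_unique x (k l : nat) (m n : int) :
    A (x *+ k - e *~ m) -> A (x *+ l - e *~ n) -> m * l = n * k.
  move=> /(AMz _ l%:Z) Am /(AMz _ k%:Z) An.
  apply/eqP; rewrite -subr_eq0; apply/eqP.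
  apply: Ae; have := AB _ _ An Am.
  rewrite !mulrzBl -!pmulrn -!mulrnA mulnC opprB addrC addrA subrK.
  by rewrite mulrzBr !mulrzA !pmulrn.
have [den /choice[num numP]] := choice Aq.
have den_gt0 x : (0 < den x)%N := (numP x).1.
have {}numP x : A (x *+ den x - e *~ num x) := (numP x).2.
pose phi x : R := (num x)%:~R / (den x)%:R.
have phiP x (k : nat) (m : int) :
    (0 < k)%N -> A (x *+ k - e *~ m) -> phi x = m%:~R / k%:R.
  move=> k0 Ak; have h := A_unique _ _ _ _ _ (numP x) Ak.
  apply/eqP; rewrite eqr_div ?pnatr_eq0 -?lt0n//; apply/eqP.
  by have := congr1 (intmul (1 : R)) h; rewrite !rmorphM/= => ->.
have phiB : zmod_morphism phi.
  move=> x y.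
  rewrite (phiP _ (den x * den y)%N (num x * den y - num y * den x)).
  - rewrite rmorphB !rmorphM/= /phi -[in RHS]mulNr.
    by rewrite addf_div ?pnatr_eq0 -?lt0n// mulNr.
  - by rewrite muln_gt0 !den_gt0.
  - have := AB _ _ (AMz _ (den y)%:Z (numP x)) (AMz _ (den x)%:Z (numP y)).
    rewrite !mulrzBl -!pmulrn -!mulrnA (mulnC (den y)).
    by rewrite mulrnBl mulrzBr !mulrzA -!pmulrn !opprD !opprK addrACA.
exists (additive_of phiB); split=> /=.
  by rewrite (phiP e 1%N 1) ?divr1// subrr.
move=> x m; apply/eqP => h.
(* Clearing the denominator of [phi x] would make [den x] times the square root of 2 an integer. *)
have /eqP := @sqrt2_irrational R (den x) (num x - m * den x) (den_gt0 x); apply.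
have -> : Num.sqrt (2 : R) = phi x - m%:~R by rewrite -h opprB addrC subrK.
rewrite mulrnBl /phi -(mulr_natr (_ / _)) divfK ?pnatr_eq0 -?lt0n//.
by rewrite rmorphB rmorphM/= -(mulr_natr m%:~R).
Qed.

(** * Reduction of real numbers modulo 1 *)

Section Wind.
Variables (R : realType) (a : R).

(* The constant [floor (- a)] makes [wind] fix the integers. *)
Definition wind (y : R) : int := Num.floor (y - a) - Num.floor (- a).

(** The representative of [y] modulo 1 in [[c, c + 1[], where [c = a + floor (- a)]; this interval
    contains 0. *)
Definition reduce (y : R) : R := y - (wind y)%:~R.

Lemma wind0 : wind 0 = 0.
Proof. by rewrite /wind sub0r subrr. Qed.

Lemma windDz y (m : int) : wind (y + m%:~R) = wind y + m.
Proof. by rewrite /wind addrAC floorDrz ?intr_int// intrKfloor addrAC. Qed.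

Lemma windz (m : int) : wind m%:~R = m.
Proof. by rewrite -[m%:~R]add0r windDz wind0 add0r. Qed.

Lemma reduceDz y (m : int) : reduce (y + m%:~R) = reduce y.
Proof. by rewrite /reduce windDz rmorphD/= opprD addrACA subrr addr0. Qed.

(** Since [y] lies strictly between two consecutive points of [a + Z], [wind] is constant near
    [y]. *)
Lemma reduce_continuous_at y :
  (forall m : int, y - a != m%:~R) -> {for y, continuous reduce}.
Proof.
move=> ya; set k := Num.floor (y - a).
have windy : \forall z \near y, wind z = wind y.
  have : y \in `](a + k%:~R), (a + (k + 1)%:~R)[.
    rewrite in_itv/= -ltrBrDl -[X in _ && X]ltrBlDl; apply/andP; split.
      by rewrite lt_neqAle eq_sym ya floor_le.
    exact: floorD1_gt.
  move=> /near_in_itvoo; apply: filterS => z; rewrite in_itv/= => /andP[kz zk].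
  congr (_ - _); apply: floor_def.
  by rewrite lerBrDl ltW//= ltrBlDl.
apply: cvg_trans (_ : (fun z => z - (wind y)%:~R) @ y --> reduce y).
  apply: near_eq_cvg; near=> z; rewrite /reduce; congr (_ - _%:~R).
  by apply/esym; near: z.
by apply: cvgB => //; exact: cvg_cst.
Unshelve. all: by end_near. Qed.

End Wind.

(** The projection maps neighbourhoods of [x] onto neighbourhoods of its class. The form is
    pointwise because reduction modulo 1 jumps at the class of [a]. *)
Lemma quotgrp_continuous_at (V : topologicalZmodType) (S : zmodClosed V)
    (T : topologicalType) (f : quotgrp S -> T) (x : V) :
  {for x, continuous (f \o quotproj S)} -> {for quotproj S x, continuous f}.
Proof.
move=> fx W nW; have := quotproj_nbhs S (fx W nW).
by apply: filterS => _ [y fyW <-].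
Qed.

(** * Recognising ws-extensions from a section *)

Section WsExtension.
Variables B X A : topologicalZmodType.
Implicit Types (j : B -> X) (p : X -> A) (s : A -> X).

(* Near [p x] the translate [a |-> s (a - p x) + x] is a section through [x]. *)
Lemma section_open_map p s : zmod_morphism p ->
  continuous s -> cancel s p -> s 0 = 0 -> is_open_map p.
Proof.
move=> pB cs sK s0 U oU; rewrite openE => _ [x Ux <-].
pose pA := additive_of pB.
have pD y z : p (y + z) = p y + p z := raddfD pA y z.
pose t (a : A) := s (a - p x) + x.
have ct : t @ p x --> t (p x).
  apply: (@continuous_comp _ _ _ (fun a => (s (a - p x), x))
    (fun z : X * X => z.1 + z.2)); last exact: add_continuous.
  apply: cvg_pair; last exact: cvg_cst.
  apply: (@continuous_comp _ _ _ (fun a => a - p x) s); last exact: cs.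
  apply: (@continuous_comp _ _ _ (fun a => (a, p x))
    (fun z : A * A => z.1 - z.2)); last exact: sub_continuous.
  by apply: cvg_pair; [exact: cvg_id|exact: cvg_cst].
have tpx : t (p x) = x by rewrite /t subrr s0 add0r.
rewrite tpx in ct.
have nU : nbhs x U := open_nbhs_nbhs (conj oU Ux).
suff: nbhs (p x) (p @` U) by [].
have : nbhs (p x) (t @^-1` U) := ct U nU.
apply: filterS => a Uta; exists (t a) => //.
by rewrite /t pD sK subrK.
Qed.

(** The last hypothesis makes every open set of [B] a preimage under [j]. As continuity of a map
    into [B], it can be tested on characters or coordinates. *)
Lemma initial_embedding j : injective j -> continuous j ->
  continuous (id : initial_topology j -> B) -> is_embedding j.
Proof.
move=> ji /continuousP cj /continuousP cid.
split=> // U; split=> [/cid|[V oV ->]].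
  by case=> V oV VU; exists V => //; rewrite VU.
exact: cj.
Qed.

(** The section itself supplies the surjectivity and the openness of [p]. *)
Lemma ws_extension_section j p s :
  zmod_morphism j -> continuous j -> injective j ->
  continuous (id : initial_topology j -> B) ->
  zmod_morphism p -> continuous p -> range j = p @^-1` [set 0] ->
  continuous s -> cancel s p -> s 0 = 0 -> ws_extension j p.
Proof.
move=> jB cj ji cid pB cp rj cs sK s0; split; last by exists s.
split=> //; last exact: initial_embedding.
by split; [move=> a; exists (s a)|exact: (section_open_map pB cs)].
Qed.

End WsExtension.

(** * Characters and the Bohr topology *)

Section BohrBasics.
Variable R : realType.

Lemma bohr_char_continuous (H : zmodType) (chi : {additive H -> circle R}) :
  continuous (chi : bohr R H -> circle R).
Proof.
exact: (@sup_initial_continuous H {additive H -> circle R} (fun=> circle R)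
  (fun chi => chi)).
Qed.

Lemma continuous_to_bohr (Y : topologicalType) (H : zmodType) (h : Y -> H) :
  (forall chi : {additive H -> circle R}, continuous (chi \o h)) ->
  continuous (h : Y -> bohr R H).
Proof. by move=> ch; apply: continuous_to_sup_initial. Qed.

Lemma bohr_hom_continuous (H K : zmodType) (f : {additive H -> K}) :
  continuous (f : bohr R H -> bohr R K).
Proof.
apply: continuous_to_bohr => chi.
exact: (@bohr_char_continuous H (chi \o f : {additive H -> circle R})).
Qed.

End BohrBasics.

Lemma topological_continuousD (Y : topologicalType) (V : topologicalZmodType)
    (f g : Y -> V) :
  continuous f -> continuous g -> continuous (fun y => f y + g y).
Proof.
move=> cf cg y; apply: (@continuous_comp _ _ _ (fun y => (f y, g y))
  (fun z : V * V => z.1 + z.2)); last exact: add_continuous.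
by apply: cvg_pair; [exact: cf|exact: cg].
Qed.

Lemma topological_continuous_sum (Y : topologicalType)
    (V : topologicalZmodType) (n : nat) (f : 'I_n -> Y -> V) :
  (forall i, continuous (f i)) -> continuous (fun y => \sum_(i < n) f i y).
Proof.
elim: n f => [|n IH] f cf.
  rewrite (_ : (fun y => _) = cst 0); first by move=> y; exact: cvg_cst.
  by apply/funext => y; rewrite big_ord0.
rewrite (_ : (fun y => _) = fun y => \sum_(i < n) f (widen_ord (leqnSn n) i) y
  + f ord_max y); last by apply/funext => y; rewrite big_ord_recr.
by apply: topological_continuousD => //; exact: IH.
Qed.

Lemma quot_additive_factor (B X Y : zmodType) (j : {additive B -> X})
    (f : {additive X -> Y}) :
  (forall u, f (j u) = 0) ->
  exists g : {additive Quotient.quot (impred j) -> Y},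
    forall x, g (\pi_(Quotient.quot (impred j))%qT x) = f x.
Proof.
move=> fj; set Q := Quotient.quot _; pose g (t : Q) := f (repr t).
have gpi x : g (\pi_Q%qT x) = f x.
  apply/eqP; rewrite -subr_eq0 -raddfB.
  have : repr (\pi_Q%qT x) - x \in impred j by rewrite Quotient.idealrBE reprK.
  by move=> /impredP[u <-]; rewrite fj.
have gB : zmod_morphism g.
  move=> t t'; rewrite -[t]reprK -[t']reprK.
  by rewrite -(raddfB (\pi_Q%qT)) !gpi raddfB.
by exists (additive_of gB).
Qed.

(** * Reduction on the circle group *)

Section CircleReduce.
Variables (R : realType) (a : R).

Definition circle_proj : R -> circle R := quotproj (impred (@intrr R)).

HB.instance Definition _ := GRing.Additive.copy circle_proj
  (quotproj (impred (@intrr R))).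

Lemma circle_proj_surj (c : circle R) : exists x, circle_proj x = c.
Proof. exact: quotproj_surj. Qed.

Lemma circle_proj_continuous : continuous circle_proj.
Proof. exact: quotproj_continuous. Qed.

Lemma circle_projz (m : int) : circle_proj m%:~R = 0.
Proof.
rewrite -(raddf0 circle_proj); apply/quotproj_eq.
by rewrite subr0; apply/impredP; exists m.
Qed.

Definition circle_reduce (c : circle R) : R :=
  reduce a (repr (c : Quotient.quot (impred (@intrr R)))).

Lemma circle_reduceE y : circle_reduce (circle_proj y) = reduce a y.
Proof.
rewrite /circle_reduce; set z := repr _.
have : circle_proj z = circle_proj y by rewrite /circle_proj /quotproj reprK.
move=> /quotproj_eq/impredP[m mzy].
by rewrite -(subrK y z) -mzy addrC reduceDz.
Qed.

Lemma circle_reduce_continuous_at y : (forall m : int, y - a != m%:~R) ->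
  {for circle_proj y, continuous circle_reduce}.
Proof.
move=> ya; apply: quotgrp_continuous_at.
rewrite (_ : _ \o _ = reduce a); last exact/funext/circle_reduceE.
exact: reduce_continuous_at.
Qed.

End CircleReduce.

(** * Lattices with a dual family of homomorphisms, under Bohr topologies *)

Section BohrLattice.
Variables (R : realType) (a : R) (B X : zmodType) (j : {additive B -> X}).
Variables (n : nat) (b : 'I_n -> B) (phi : 'I_n -> {additive X -> R}).
Hypothesis b_span : forall u, exists m : 'I_n -> int, u = \sum_i b i *~ m i.
Hypothesis phi_b : forall i k, phi i (j (b k)) = (i == k)%:R.
Hypothesis phi_avoid : forall i x (m : int), phi i x - a != m%:~R.

Let coord_comb (m : 'I_n -> int) i :
  phi i (j (\sum_k b k *~ m k)) = (m i)%:~R.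
Proof.
rewrite !raddf_sum (bigD1 i)//= !raddfMz phi_b eqxx big1 ?addr0// => k ki.
by rewrite !raddfMz phi_b eq_sym (negbTE ki) mul0rz.
Qed.

Let j_inj : injective j.
Proof.
apply: raddf_inj => u; have [m ->] := b_span u => jm0.
apply: big1 => i _; suff -> : m i = 0 by rewrite mulr0z.
by apply/eqP; rewrite -(intr_eq0 R) -coord_comb jm0 raddf0.
Qed.

(** The coefficients are real lifts of circle elements: [phi i x] need not be an integer, and a
    circle element has only integer multiples. *)
Let char_of (r : 'I_n -> R) x := \sum_i circle_proj (r i * phi i x).

Let char_of_additive r : zmod_morphism (char_of r).
Proof.
move=> x y; rewrite /char_of -sumrB; apply: eq_bigr => i _.
by rewrite raddfB mulrBr raddfB.
Qed.

Let char_of_comb r (m : 'I_n -> int) :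
  char_of r (j (\sum_k b k *~ m k)) = \sum_i circle_proj (r i * (m i)%:~R).
Proof. by apply: eq_bigr => i _; rewrite coord_comb. Qed.

(** On the lattice the [phi i] are integers, so any real lift [r i] of [chi (b i)] gives the right
    value. *)
Let char_extend (chi : {additive B -> circle R}) :
  exists r, forall u, char_of r (j u) = chi u.
Proof.
have [r rP] := choice (fun i => circle_proj_surj (chi (b i))).
exists r => u; have [m ->] := b_span u.
rewrite char_of_comb raddf_sum; apply: eq_bigr => i _.
by rewrite raddfMz -rP -raddfMz mulrzr.
Qed.

Let Q := Quotient.quot (impred j).
Let lattice_part x := j (\sum_i b i *~ wind a (phi i x)).
Let lift (t : Q) : X := repr t - lattice_part (repr t).

Let lift_continuous : continuous (lift : bohr R Q -> bohr R X).
Proof.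
apply: continuous_to_bohr => chi.
have [r rP] := char_extend (chi \o j).
pose chi0 := additive_of (char_of_additive r).
have [chi1 chi1P] := @quot_additive_factor _ _ _ j (chi \- chi0)
  (fun u => etrans (congr1 (fun c => chi (j u) - c) (rP u)) (subrr _)).
(* Each [phi i] is an integer on the lattice, so modulo 1 it descends to a character of the
   quotient. *)
have psi_ex i : exists psi : {additive Q -> circle R},
    forall x, psi (\pi_Q%qT x) = circle_proj (phi i x).
  apply: (@quot_additive_factor _ _ _ j (@circle_proj R \o phi i)) => u /=.
  by have [m ->] := b_span u; rewrite coord_comb circle_projz.
have [psi psiP] := choice psi_ex.
rewrite (_ : chi \o lift = fun t => chi1 t +
    \sum_i circle_proj (r i * circle_reduce a (psi i t))); last first.
  apply/funext => t; rewrite -{2 3}[t]reprK chi1P /lift /=; set x := repr t.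
  rewrite raddfB -[chi (lattice_part x)](rP _) char_of_comb.
  rewrite -addrA; congr (_ + _).
  rewrite -sumrN [RHS]addrC /char_of -sumrB.
  apply: eq_bigr => i _; rewrite psiP circle_reduceE /reduce mulrBr.
  by rewrite (raddfB (@circle_proj R)) addrAC subrr add0r.
apply: topological_continuousD; first exact: bohr_char_continuous.
apply: topological_continuous_sum => i t.
apply: (@continuous_comp (bohr R Q) _ _
  (fun t => r i * circle_reduce a (psi i t)) (@circle_proj R));
  last exact: circle_proj_continuous.
apply: (@continuous_comp (bohr R Q) _ _ (fun t => circle_reduce a (psi i t))
  (fun y => r i * y)); last exact: mulrl_continuous.
apply: (@continuous_comp (bohr R Q) _ _ (psi i) (circle_reduce a)).
  exact: bohr_char_continuous.
(* By [phi_avoid] the value [psi i t] is never the class of [a], where [circle_reduce] jumps. *)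
by rewrite -[t]reprK psiP; apply: circle_reduce_continuous_at.
Qed.

Lemma bohr_lattice_ws_extension :
  @ws_extension (bohr R B) (bohr R X) (bohr R Q) j \pi_Q%qT.
Proof.
apply: (@ws_extension_section (bohr R B) (bohr R X) (bohr R Q) _ _ lift).
- exact: raddfB.
- exact: bohr_hom_continuous.
- exact: j_inj.
(* Embedding: each character of [B] is the restriction of a character of [X]. *)
- apply: continuous_to_bohr => chi.
  have [r rP] := char_extend chi.
  rewrite (_ : chi \o id = additive_of (char_of_additive r) \o j); last first.
    by apply/funext => u; rewrite /= rP.
  move=> u; apply: (@continuous_comp
    (initial_topology (j : bohr R B -> bohr R X)) (bohr R X) _ j
    (additive_of (char_of_additive r))).
    exact: initial_continuous.
  exact: bohr_char_continuous.
- exact: (raddfB (\pi_Q%qT)).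
- exact: (@bohr_hom_continuous R X Q (\pi_Q%qT)).
- apply/seteqP; split=> x /=.
    move=> [u _ <-]; apply/eqP; rewrite -(raddf0 (\pi_Q%qT)).
    by rewrite -Quotient.idealrBE subr0; apply/impredP; exists u.
  move/eqP; rewrite -(raddf0 (\pi_Q%qT)) -Quotient.idealrBE subr0.
  by move=> /impredP[u <-]; exists u.
- exact: lift_continuous.
- move=> t; rewrite -[RHS]reprK; apply/eqP; rewrite -Quotient.idealrBE.
  rewrite /lift addrAC subrr add0r rpredN.
  by apply/impredP; eexists.
(* The chosen representative of 0 may be any lattice point, but [wind] recovers its coefficients, so
   all of it is subtracted. *)
- rewrite /lift; set x := repr _.
  have : x \in impred j.
    by rewrite -[x]subr0 Quotient.idealrBE reprK (raddf0 (\pi_Q%qT)).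
  move=> /impredP[u <-]; have [m ->] := b_span u.
  apply/eqP; rewrite subr_eq0; apply/eqP; congr (j _).
  by apply: eq_bigr => i _; rewrite coord_comb windz.
Qed.

End BohrLattice.

(** * Adding a direct summand *)

Lemma continuous_to_dsum (Y : topologicalType) (A B : topologicalZmodType)
    (f : Y -> A) (g : Y -> B) :
  continuous f -> continuous g -> continuous (fun y => (f y, g y) : dsum A B).
Proof. by move=> cf cg y; exact: (cvg_pair (cf y) (cg y)). Qed.

(** The five identities make [X'] the direct sum of [X] and [Y]. The four maps are homomorphisms,
    hence Bohr continuous, and [i2] extends the section to [Y]. *)
Lemma bohr_ws_extension_summand (R : realType) (B X X' A Y : zmodType)
    (j : B -> X) (p : X -> A)
    (i1 : {additive X -> X'}) (r : {additive X' -> X})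
    (i2 : {additive Y -> X'}) (q : {additive X' -> Y}) :
  cancel i1 r -> (forall y, r (i2 y) = 0) ->
  (forall x, q (i1 x) = 0) -> cancel i2 q ->
  (forall z, i1 (r z) + i2 (q z) = z) ->
  @ws_extension (bohr R B) (bohr R X) (bohr R A) j p ->
  @ws_extension (bohr R B) (bohr R X') (dsum (bohr R A) (bohr R Y))
    (i1 \o j) (fun z => (p (r z), q z)).
Proof.
move=> i1K ri2 qi1 i2K i12 [[[jB cj] [pB cp] _ [ji jopen] rj]] [s [cs sK s0]].
pose jA := additive_of jB; pose pA := additive_of pB.
apply: (@ws_extension_section (bohr R B) (bohr R X')
  (dsum (bohr R A) (bohr R Y)) _ _ (fun t => i1 (s t.1) + i2 t.2)).
- exact: (raddfB (i1 \o jA)).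
- exact: (@bohr_hom_continuous R B X' (i1 \o jA)).
- by move=> u v /(can_inj i1K)/ji.
- apply/continuousP => U oU; have [V oV ->] := (jopen U).1 oU.
  have /continuousP/(_ _ oV) or : continuous (r : bohr R X' -> bohr R X).
    exact: bohr_hom_continuous.
  by exists (r @^-1` V) => //; apply/seteqP; split=> u /=; rewrite i1K.
- move=> x y; rewrite -[LHS]/(pA (r (x - y)), q (x - y)).
  by rewrite !raddfB.
- apply: continuous_to_dsum.
    exact: (@bohr_hom_continuous R X' A (pA \o r)).
  exact: bohr_hom_continuous.
- apply/seteqP; split=> [_ [u _ <-]|z [prz qz]] /=.
    have pju : p (j u) = 0.
      by have : range j (j u) by [exists u]; rewrite rj.
    by rewrite i1K qi1 pju.
  have : (p @^-1` [set 0]) (r z) by [].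
  rewrite -rj => -[u _ juz]; exists u => //=.
  by rewrite juz -[RHS]i12 qz raddf0 addr0.
- pose D := dsum (bohr R A) (bohr R Y).
  apply: (@topological_continuousD D (bohr R X')
    (fun t => i1 (s t.1)) (fun t => i2 t.2)) => t.
    apply: (@continuous_comp D (bohr R X) (bohr R X') (fun t => s t.1) i1).
      apply: (@continuous_comp D (bohr R A) _ fst s); last exact: cs.
      exact: cvg_fst.
    exact: bohr_hom_continuous.
  apply: (@continuous_comp D (bohr R Y) (bohr R X') snd i2).
    exact: cvg_snd.
  exact: bohr_hom_continuous.
- move=> [t y] /=; rewrite (raddfD r) (raddfD q) i1K ri2 qi1 i2K.
  by rewrite addr0 add0r sK.
- by rewrite /= s0 !raddf0 addr0.
Qed.

(** * Splitting a power along a set of coordinates *)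

Section Coordinates.
Variables (I : Type) (V : zmodType).
Implicit Type A : set I.

Lemma valL_in (A : set I) (v : V) (f : A -> V) (d : A) :
  valL_ v f (set_val d) = f d.
Proof. exact: (congr1 (fun g => g d) (valLK v f)). Qed.

Lemma valL_out (A : set I) (v : V) (f : A -> V) (i : I) :
  ~ A i -> valL_ v f i = v.
Proof. by move=> nAi; rewrite /= oinv_set_val insubN//= notin_setE. Qed.

Lemma valL_zmod_morphism A :
  zmod_morphism (valL_ 0 : (A -> V) -> (I -> V)).
Proof.
move=> f g; apply/funext => i; have [Ai|nAi] := pselect (A i).
  have -> : i = set_val (SigSub (mem_set Ai)) by [].
  by rewrite -[RHS]/(valL_ 0 f _ - valL_ 0 g _) !valL_in.
by rewrite -[RHS]/(valL_ 0 f _ - valL_ 0 g _) !valL_out// subr0.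
Qed.

Lemma sigL_zmod_morphism A : zmod_morphism (sigL A : (I -> V) -> (A -> V)).
Proof. by []. Qed.

Lemma valL_sigLC A (x : I -> V) :
  valL_ 0 (sigL A x) + valL_ 0 (sigL (~` A) x) = x.
Proof.
apply/funext => i; rewrite -[LHS]/(valL_ 0 _ i + valL_ 0 _ i).
have [Ai|nAi] := pselect (A i).
  rewrite [X in _ + X]valL_out ?addr0; last by [].
  exact: (valL_in 0 (sigL A x) (SigSub (mem_set Ai))).
rewrite valL_out// add0r.
exact: (valL_in 0 (sigL (~` A) x) (SigSub (@mem_set _ (~` A) i nAi))).
Qed.

Lemma sigLC_valL A (f : A -> V) : sigL (~` A) (valL_ 0 f) = 0.
Proof. by apply/funext => d; exact: (valL_out 0 f (set_mem (valP d))). Qed.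

Lemma sigL_valLC A (f : ~` A -> V) : sigL A (valL_ 0 f) = 0.
Proof.
by apply/funext => d; exact: (valL_out 0 f (fun nAd => nAd (set_mem (valP d)))).
Qed.

End Coordinates.

Lemma finite_set_bij_ord (I : Type) (J : set I) : finite_set J ->
  exists n, exists f : J -> 'I_n, bijective f.
Proof.
move=> [n Jn]; exists n.
have /card_bijP[f [g fK gK]] : (J #= [set: 'I_n])%card :=
  card_eq_trans Jn card_II.
exists (val \o f), (fun i => g (SigSub (in_setT i))) => [d|i] /=.
  by rewrite -[RHS]fK; congr g; apply: val_inj.
by rewrite gK.
Qed.

(** * Powers under Bohr topologies, with finitely many coordinates divided *)

Section BohrPowers.
Variables (R : realType) (K : topologicalZmodType).
Variable iota : {additive int -> K}.
Hypothesis iota_inj : injective iota.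

(** Injectivity gives [iota 1] infinite order. Even for [K = R] this [phi] is not the identity,
    which attains the square root of 2. *)
Lemma unit_avoiding_hom : exists phi : {additive K -> R},
  (forall m : int, phi (iota m) = m%:~R) /\
  forall x (m : int), phi x - Num.sqrt 2 != m%:~R.
Proof.
have iotaE m : iota m = iota 1 *~ m by rewrite -raddfMz intz.
have [m|phi [phi1 phi_avoid]] := @irrational_avoiding_hom R K (iota 1).
  by rewrite -iotaE -[0](raddf0 iota) => /iota_inj.
by exists phi; split => // m; rewrite iotaE raddfMz phi1.
Qed.

Lemma bohr_pow_ws_extension (I : Type) (J : set I) : finite_set J ->
  @ws_extension (bohr R (J -> int)) (bohr R (J -> K))
    (bohr R (Quotient.quot (impred (pwadd J iota))))
    (pwadd J iota) \pi_(Quotient.quot (impred (pwadd J iota)))%qT.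
Proof.
move=> /finite_set_bij_ord[n [f [g fK gK]]].
have [phi [phiz phi_avoid]] := unit_avoiding_hom.
have phigB i : zmod_morphism (fun x : J -> K => phi (x (g i))).
  by move=> x y; rewrite -raddfB.
apply: (@bohr_lattice_ws_extension R (Num.sqrt 2) _ _ _ n
  (fun i d => (f d == i)%:R) (fun i => additive_of (phigB i))).
- move=> u; exists (u \o g); apply/funext => d.
  have evB : zmod_morphism (fun h : J -> int => h d) by [].
  rewrite -[RHS]/(additive_of evB _) raddf_sum (bigD1 (f d))// big1 => [|i fdi].
    by rewrite raddfMz/= eqxx mulrzz mul1r fK addr0.
  by rewrite raddfMz/= eq_sym (negbTE fdi) mul0rz.
- by move=> i k; rewrite /= /pwmap /= phiz gK; case: (i == k).
- by move=> i x m; exact: phi_avoid.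
Qed.

Lemma bohr_coord_ws_extension (I : Type) (J : set I) : finite_set J ->
  @ws_extension (bohr R (J -> int)) (bohr R (I -> K))
    (dsum (bohr R (Quotient.quot (impred (pwadd J iota))))
          (bohr R (~` J -> K)))
    (coord_incl J iota) (coord_quot_pow J iota).
Proof.
move=> finJ.
apply: (@bohr_ws_extension_summand R _ _ _ _ _ _ _
  (additive_of (@valL_zmod_morphism I K J))
  (additive_of (@sigL_zmod_morphism I K J))
  (additive_of (@valL_zmod_morphism I K (~` J)))
  (additive_of (@sigL_zmod_morphism I K (~` J)))
  _ _ _ _ _ (bohr_pow_ws_extension finJ)).
- exact: valLK.
- exact: sigL_valLC.
- exact: sigLC_valL.
- exact: valLK.
- exact: valL_sigLC.
Qed.

End BohrPowers.

(** The homomorphisms dual to the standard basis are [phi] of the entries, since the entries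
    themselves avoid no real value. *)
Lemma bohr_rV_ws_extension (R : realType) (n : nat) :
  @ws_extension (bohr R 'rV[int]_n) (bohr R 'rV[R]_n)
    (bohr R (Quotient.quot (impred (map_mx (@intrr R)))))
    (map_mx (@intrr R))
    \pi_(Quotient.quot (impred (map_mx (@intrr R))))%qT.
Proof.
have [phi [phiz phi_avoid]] :=
  @unit_avoiding_hom R R (@intrr R) (@intr_inj R).
have phicB i : zmod_morphism (fun x : 'rV[R]_n => phi (x 0 i)).
  by move=> x y; rewrite !mxE raddfB.
apply: (@bohr_lattice_ws_extension R (Num.sqrt 2) _ _ _ n
  (fun i => delta_mx 0 i) (fun i => additive_of (phicB i))).
- move=> u; exists (u 0); rewrite [LHS]row_sum_delta.
  by apply: eq_bigr => i _; rewrite -scaler_int intz.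
- by move=> i k; rewrite /= !mxE phiz eqxx; case: (i == k).
- by move=> i x m; exact: phi_avoid.
Qed.

(** * Discrete integers and product topologies *)

Section DiscreteInt.
Variables (Y : topologicalType).

Lemma dint_discrete (f : dint -> Y) : continuous f.
Proof.
move=> m W nW; suff : nbhs (m : dint) (f @^-1` W) by [].
have : nbhs (m : dint) [set m].
  exact: (@discrete_set1 (discrete_topology int)).
by apply: (@filterS dint (nbhs (m : dint))) => _ ->; exact: nbhs_singleton nW.
Qed.

(** The open unit ball around an integer contains no other integer. *)
Lemma continuous_to_dint (R : realType) (h : Y -> dint) :
  continuous (fun y => (h y : int)%:~R : R) -> continuous h.
Proof.
move=> ch y W nW; suff : nbhs y (h @^-1` W) by [].
pose hR y : R := (h y : int)%:~R.
have nh : nbhs y (hR @^-1` ball (hR y) 1) := ch y _ (nbhsx_ballx _ 1 ltr01).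
apply: (@filterS Y (nbhs y) _ _ _ _ nh) => z hzy /=.
suff -> : h z = h y by exact: nbhs_singleton nW.
apply/esym/eqP; move: hzy; rewrite /= -ball_normE /= /hR -rmorphB/=.
by rewrite -intr_norm -[1]/(1%:~R) ltr_int -[1]add0r ltzD1 normr_le0 subr_eq0.
Qed.

End DiscreteInt.

Section Powers.
Variables (D : Type) (K : topologicalZmodType).

Lemma power_coord_continuous (d : D) : continuous (fun x : power D K => x d).
Proof. exact: (@sup_initial_continuous _ D (fun=> K) (fun d f => f d)). Qed.

Lemma continuous_to_power (Y : topologicalType) (f : Y -> power D K) :
  (forall d, continuous (fun y => f y d)) -> continuous f.
Proof.
move=> cf.
exact: (@continuous_to_sup_initial Y _ D (fun=> K) (fun d f => f d)).
Qed.

End Powers.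

(** * Powers of a subgroup of the reals with the product topology *)

Section RealSubgroup.
Variables (R : realType) (G : zmodClosed R) (hG : forall m : int, m%:~R \in G).
Variable a : R.

Let Q := quotgrp (impred (intsub hG)).
Let qproj : {additive subgrp G -> Q} := quotproj (impred (intsub hG)).

Definition subgrp_reduce (x : subgrp G) : subgrp G :=
  x - intsub hG (wind a (val x)).

Definition subgrp_lift (t : Q) : subgrp G :=
  subgrp_reduce (repr (t : Quotient.quot (impred (intsub hG)))).

Lemma subgrp_liftE x : subgrp_lift (qproj x) = subgrp_reduce x.
Proof.
rewrite /subgrp_lift; set z := repr _.
have : qproj z = qproj x by rewrite /qproj/= /quotproj reprK.
move=> /quotproj_eq/impredP[m mzx].
rewrite -(subrK x z) -mzx /subgrp_reduce.
have -> : val (intsub hG m + x) = val x + m%:~R by rewrite raddfD addrC.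
by rewrite windDz raddfD opprD [X in X + _]addrC addrACA subrr addr0.
Qed.

Lemma subgrp_liftK : cancel subgrp_lift qproj.
Proof.
move=> t; have [x <-] := quotproj_surj t; rewrite subgrp_liftE.
apply/quotproj_eq; rewrite /subgrp_reduce addrAC subrr add0r rpredN.
by apply/impredP; eexists.
Qed.

Lemma subgrp_lift0 : subgrp_lift 0 = 0.
Proof.
rewrite -[0 in LHS](raddf0 qproj) subgrp_liftE.
by rewrite /subgrp_reduce raddf0 wind0 raddf0 subr0.
Qed.

Lemma val_subgrp_continuous : continuous (val : subgrp G -> R).
Proof. exact: (@initial_continuous (subgrp G) R val). Qed.

(** If [y - a] were an integer for some [y] in [G], then [a] would lie in [G], which contains the
    integers. *)
Lemma subgrp_lift_continuous : a \notin G -> continuous subgrp_lift.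
Proof.
move=> aG t; have [x <-] := quotproj_surj t; apply: quotgrp_continuous_at.
rewrite (_ : _ \o _ = subgrp_reduce); last exact/funext/subgrp_liftE.
suff creduce : continuous subgrp_reduce by exact: creduce.
apply: continuous_to_initial => y.
rewrite (_ : _ \o _ = reduce a \o val); last first.
  by apply/funext => z; exact: raddfB.
apply: (@continuous_comp (subgrp G) R R val (reduce a)).
  exact: val_subgrp_continuous.
apply: reduce_continuous_at => m; apply: contraNneq aG => yam.
rewrite -(subKr (val y) a) yam rpredB//; exact: valP.
Qed.

Variables (I : Type) (J : set I).

Let j : power J dint -> power I (subgrp G) :=
  coord_incl J (intsub hG).
Let p : power I (subgrp G) -> dsum (power J Q) (power (~` J) (subgrp G)) :=
  coord_quot J (intsub hG).

(** The section is [subgrp_lift] on the coordinates in [J] and the identity elsewhere. The condition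
    on [a] is vacuous for empty [J], so that case is covered even when [G] is all of [R]. *)
Lemma coord_ws_extension : (J -> a \notin G) ->
  @ws_extension (power J dint) (power I (subgrp G))
    (dsum (power J Q) (power (~` J) (subgrp G))) j p.
Proof.
move=> aG.
pose D := dsum (power J Q) (power (~` J) (subgrp G)).
pose s (t : D) : power I (subgrp G) :=
  valL_ 0 (pwmap subgrp_lift t.1) + valL_ 0 t.2.
have sJ t d : s t (set_val d) = subgrp_lift (t.1 d).
  rewrite -[LHS]/(valL_ 0 _ _ + valL_ 0 _ _) valL_in valL_out ?addr0//.
  by apply; exact: (set_mem (valP d)).
have sCJ t (d : ~` J) : s t (set_val d) = t.2 d.
  rewrite -[LHS]/(valL_ 0 _ _ + valL_ 0 _ _) valL_in valL_out ?add0r//.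
  exact: (set_mem (valP d)).
have jJ m (d : J) : j m (set_val d) = intsub hG (m d) by exact: valL_in.
have split_coord (P : I -> Prop) :
    (forall d : J, P (set_val d)) -> (forall d : ~` J, P (set_val d)) ->
    forall i, P i.
  move=> PJ PCJ i; have [Ji|nJi] := pselect (J i).
    exact: (PJ (SigSub (mem_set Ji))).
  exact: (PCJ (SigSub (@mem_set _ (~` J) i nJi))).
apply: (@ws_extension_section _ _ D _ _ s).
- exact: (raddfB (additive_of (@valL_zmod_morphism I (subgrp G) J)
    \o pwadd J (intsub hG))).
- apply: continuous_to_power; apply: split_coord => d.
    rewrite (_ : (fun _ => _) = (fun m => intsub hG (m d))); last first.
      by apply/funext => m; exact: jJ.
    move=> m; apply: (@continuous_comp (power J dint) dint _ (fun m => m d)).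
      exact: power_coord_continuous.
    exact: dint_discrete.
  rewrite (_ : (fun _ => _) = cst 0); first exact: cst_continuous.
  by apply/funext => m; exact: (valL_out _ _ (set_mem (valP d))).
- move=> m m' jmm'; apply/funext => d; apply: (@intr_inj R).
  by have := congr1 (fun x => val (x (set_val d))) jmm'; rewrite !jJ.
(* Embedding: [m d] is read off [j m] as a real coordinate. *)
- apply: continuous_to_power => d; apply: (@continuous_to_dint _ R).
  rewrite (_ : (fun _ => _) =
      (fun x : power I (subgrp G) => val (x (set_val d))) \o j).
    move=> m; apply: (@continuous_comp (initial_topology j)
      (power I (subgrp G)) R j).
      exact: initial_continuous.
    apply: (@continuous_comp (power I (subgrp G)) (subgrp G) R
      (fun x => x (set_val d)) val).
      exact: power_coord_continuous.
    exact: val_subgrp_continuous.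
  by apply/funext => m; rewrite /= jJ.
- move=> x y.
  exact: (congr2 pair (raddfB (pwadd J qproj)
    (sigL J x) (sigL J y)) erefl).
- apply: continuous_to_dsum; apply: continuous_to_power => d.
    move=> x; apply: (@continuous_comp (power I (subgrp G)) (subgrp G) Q
      (fun x => x (set_val d)) qproj).
      exact: power_coord_continuous.
    exact: quotproj_continuous.
  exact: power_coord_continuous.
- apply/seteqP; split=> [_ [m _ <-]|x px0].
    congr pair; apply/funext => d; last first.
      exact: (valL_out _ _ (set_mem (valP d))).
    rewrite -[LHS]/(quotproj _ (j m (set_val d))) jJ -[RHS]/(0 : Q).
    rewrite -(raddf0 qproj).
    by apply/quotproj_eq; rewrite subr0; apply/impredP; exists (m d).
  have xJ (d : J) : exists k, intsub hG k = x (set_val d).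
    apply/impredP; rewrite -[x _]subr0; apply/quotproj_eq; rewrite raddf0.
    exact: (congr1 (fun t : D => t.1 d) px0).
  have [m mP] := choice xJ; exists m => //.
  apply/funext; apply: split_coord => d; first by rewrite jJ.
  rewrite -[RHS]/((p x).2 d) px0.
  exact: (valL_out _ _ (set_mem (valP d))).
- apply: continuous_to_power; apply: split_coord => d.
    rewrite (_ : (fun _ => _) = (fun t : D => subgrp_lift (t.1 d))); last first.
      by apply/funext => t; exact: sJ.
    move=> t; apply: (@continuous_comp D Q _ (fun t => t.1 d) subgrp_lift).
      apply: (@continuous_comp D (power J Q) Q fst (fun f => f d)).
        exact: cvg_fst.
      exact: power_coord_continuous.
    exact: (subgrp_lift_continuous (aG d)).
  rewrite (_ : (fun _ => _) = (fun t : D => t.2 d)); last first.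
    by apply/funext => t; exact: sCJ.
  move=> t; apply: (@continuous_comp D (power (~` J) (subgrp G)) _ snd
    (fun f => f d)).
    exact: cvg_snd.
  exact: power_coord_continuous.
- move=> [t y]; congr pair; apply/funext => d.
    by rewrite /pwmap /= sJ subgrp_liftK.
  exact: sCJ.
- apply/funext; apply: split_coord => d; first by rewrite sJ subgrp_lift0.
  by rewrite sCJ.
Qed.

End RealSubgroup.

(** The condition in the first item excludes [G = R] with [J] nonempty, where a section would yield
    a continuous injection of the circle into the line. *)
Theorem corollary5p21 (R : realType) (G : zmodClosed R)
    (hG : forall m : int, m%:~R \in G)
    (I : Type) (hI : infinite_set [set: I]) (J : set I) (n : nat) :
  [/\ (J = set0 \/ exists x : R, x \notin G) ->
        @ws_extension (power J dint) (power I (subgrp G))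
          (dsum (power J (quotgrp (impred (intsub hG))))
                (power (~` J) (subgrp G)))
          (coord_incl J (intsub hG)) (coord_quot J (intsub hG)),
      @ws_extension (bohr R 'rV[int]_n) (bohr R 'rV[R]_n)
        (bohr R (Quotient.quot (impred (map_mx (@intrr R)))))
        (map_mx (@intrr R))
        \pi_(Quotient.quot (impred (map_mx (@intrr R))))%qT,
      finite_set J ->
        @ws_extension (bohr R (J -> int)) (bohr R (I -> subgrp G))
          (dsum (bohr R (Quotient.quot (impred (pwadd J (intsub hG)))))
                (bohr R (~` J -> subgrp G)))
          (coord_incl J (intsub hG)) (coord_quot_pow J (intsub hG)) &
      finite_set J ->
        @ws_extension (bohr R (J -> int)) (bohr R (I -> R))
          (dsum (bohr R (Quotient.quot (impred (pwadd J (@intrr R)))))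
                (bohr R (~` J -> R)))
          (coord_incl J (@intrr R)) (coord_quot_pow J (@intrr R))].
Proof.
split.
- case=> [J0|[a aG]]; last by apply: (@coord_ws_extension _ _ _ a).
  (* For empty [J] the cut point is arbitrary. *)
  apply: (@coord_ws_extension _ _ _ 0) => d.
  by have := set_mem (valP d); rewrite {1}J0.
- exact: bohr_rV_ws_extension.
- apply: bohr_coord_ws_extension => m m' /(congr1 val) /=.
  exact: intr_inj.
- exact/bohr_coord_ws_extension/intr_inj.
Qed.
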